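(* Let $K\ge 1$, $\alpha\in(0,1)$, and let $E_1,\dots,E_K$ be raw e-values for hypotheses $H_1,\dots,H_K$ under the true probability measure $\mathbb P$, with set of true null indices $\mathcal N$ and $K_0=|\mathcal N|$. Then the e-BH procedure at level $\alpha$ has false discovery rate at most $K_0\alpha/K$. Explicitly: let $\phi_1,\dots,\phi_K:[0,\infty]\to[0,\infty]$ be increasing functions (for instance $\phi_k(x)=b_kx$ with constants $b_k\ge1$) such that either (a) $(E_1,\dots,E_K)$ is PRDS and for every $k\in\mathcal K$, $\max_{x\in K/\mathcal K} x\,\mathbb Q(\alpha\phi_k(E_k)\ge x)\le\alpha$ for all $\mathbb Q\in H_k$; or (b) (with no assumption on the dependence among $E_1,\dots,E_K$) for every $k\in\mathcal K$, $\mathbb E^{\mathbb Q}[T(\alpha\phi_k(E_k))]\le\alpha$ for all $\mathbb Q\in H_k$. Then the base e-BH procedure $\mathcal G(\alpha)$ applied to the boosted e-values $E_k'=\phi_k(E_k)$, $k\in\mathcal K$, satisfies $$\mathbb E\left[\frac{F_{\mathcal G(\alpha)}}{R_{\mathcal G(\alpha)}}\right]\le\frac{K_0\alpha}{K}.$$ In particular, the base e-BH procedure applied to arbitrarily dependent raw e-values ($E_k'=E_k$) has false discovery rate at most $K_0\alpha/K$.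
   Context: $\mathcal K=\{1,\dots,K\}$ and $K/\mathcal K:=\{K/k:k\in\mathcal K\}$. Each hypothesis $H_k$ is a set of probability measures on the sample space; $\mathbb P$ is the true (unknown) probability measure, $\mathbb E$ is expectation under $\mathbb P$, $\mathcal N=\{k\in\mathcal K:\mathbb P\in H_k\}$ is the set of indices of true nulls, and $K_0=|\mathcal N|$. Each $E_k$ is a $[0,\infty]$-valued random variable such that $\mathbb E^{\mathbb Q}[E_k]\le1$ for all $\mathbb Q\in H_k$ (so $\mathbb E[E_k]\le1$ for $k\in\mathcal N$). ''Increasing'' and ''decreasing'' are in the non-strict sense. Base e-BH procedure $\mathcal G(\alpha)$: given realized values $e'_1,\dots,e'_K\in[0,\infty]$, let $e'_{[1]}\ge\dots\ge e'_{[K]}$ be their order statistics from largest to smallest, let $k_e^*=\max\{k\in\mathcal K: k e'_{[k]}/K\ge1/\alpha\}$ with $\max\varnothing=0$, and reject the hypotheses with the $k_e^*$ largest values. $\mathcal G(\alpha)$ denotes also the (random) set of rejected indices. $F_{\mathcal G}=|\mathcal G\cap\mathcal N|$ is the number of false discoveries, $R_{\mathcal G}=|\mathcal G|$ the number of discoveries, $0/0=0$, and the false discovery rate (FDR) is $\mathbb E[F_{\mathcal G}/R_{\mathcal G}]$. Truncation function: $T:[0,\infty]\to[0,K]$, where $T(x)$ is the largest element of $K/\mathcal K\cup\{0\}$ that is no larger than $x$, i.e. $T(x)=\frac{K}{\lceil K/x\rceil}\mathbf 1_{\{x\ge1\}}$ with $T(\infty)=K$. PRDS for e-values: a set $A$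 is decreasing if $\mathbf x\in A$ and $\mathbf y\le\mathbf x$ componentwise imply $\mathbf y\in A$. The random vector $\mathbf E=(E_1,\dots,E_K)$ is PRDS if for every $k\in\mathcal N$ and every decreasing (Borel) set $A\subseteq[0,\infty]^K$, the function $x\mapsto\mathbb P(\mathbf E\in A\mid E_k\ge x)$ is decreasing on $[0,\infty)$ (where the conditioning event has positive probability). *)

(* Defs.v *)
From mathcomp Require Import all_boot all_order all_algebra.
From mathcomp Require Import all_classical all_reals all_analysis measurable_realfun.

Set Implicit Arguments.
Unset Strict Implicit.
Unset Printing Implicit Defensive.

Import Order.TTheory GRing.Theory Num.Theory.

Local Open Scope classical_set_scope.
Local Open Scope ring_scope.
Local Open Scope ereal_scope.

(* The index set {1, ..., K} is represented by 'I_K: the ordinal i stands for  *)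
(* the index i.+1, so that K/{1, ..., K} is {K / i.+1 : i < K}.                *)

Section eBH.
Context {R : realType} {K : nat}.
Implicit Types (e : 'I_K -> \bar R) (alpha : R).

(* Indices listed by decreasing value of e; ties are broken by index.  The     *)
(* rejected set below does not depend on this tie-breaking, since in case of   *)
(* a tie e_[k] = e_[k+1] with k meeting the threshold, k+1 meets it as well.   *)
Definition ranking e : seq 'I_K := sort (fun i j => e j <= e i) (enum 'I_K).

(* order_stat e i is e_[i+1], the (i+1)-th largest value. *)
Definition order_stat e (i : 'I_K) : \bar R := nth 0 [seq e j | j <- ranking e] i.

Definition kstar alpha e : nat :=
  \max_(i < K | (alpha^-1)%:E <= i.+1%:R%:E * order_stat e i * (K%:R^-1)%:E)
    i.+1.

Definition ebh alpha e : {set 'I_K} :=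
  [set k in take (kstar alpha e) (ranking e)]%SET.

(* The empty max is 0, so this is the largest element of K/{1, ..., K} U {0}   *)
(* that is no larger than x. *)
Definition truncation (x : \bar R) : R :=
  \big[Num.max/0%R]_(i < K | (K%:R / i.+1%:R)%:E <= x) (K%:R / i.+1%:R)%R.

End eBH.
Arguments truncation {R} K x.

Section Hypotheses.
Context {d : measure_display} {Omega : measurableType d} {R : realType}.
Context {K : nat}.
Implicit Types (P : probability Omega R) (H : set (probability Omega R)).

Definition true_nulls (Hs : 'I_K -> set (probability Omega R)) P : {set 'I_K} :=
  [set k | `[< Hs k P >]]%SET.

Definition e_value H (X : Omega -> \bar R) : Prop :=
  [/\ measurable_fun [set: Omega] X,
      forall w, 0 <= X w &
      forall Q, H Q -> \int[Q]_w X w <= 1].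

(* Division by zero yields 0 in MathComp, hence 0 / 0 = 0. *)
Definition fdp (N G : {set 'I_K}) : R := (#|G :&: N|%:R / #|G|%:R)%R.

Definition fdr P (N : {set 'I_K}) (G : Omega -> {set 'I_K}) : \bar R :=
  'E_P[fun w => fdp N (G w)].

Definition decreasing_set (A : set (K.-tuple (\bar R))) : Prop :=
  (forall x, A x -> forall k, 0 <= tnth x k) /\
  (forall x y, A x -> (forall k, 0 <= tnth y k <= tnth x k) -> A y).

(* Only meaningful if P B > 0. *)
Definition cond_prob P (A B : set Omega) : R :=
  (fine (P (A `&` B)) / fine (P B))%R.

Definition PRDS P (N : {set 'I_K}) (E : 'I_K -> Omega -> \bar R) : Prop :=
  forall k, k \in N ->
  forall A : set (K.-tuple (\bar R)), measurable A -> decreasing_set A ->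
  let EA := [set w | A [tuple E j w | j < K]] in
  let Ek x := [set w | x%:E <= E k w] in
  forall x y : R, (0 <= x <= y)%R -> 0 < P (Ek x) -> 0 < P (Ek y) ->
  (cond_prob P EA (Ek y) <= cond_prob P EA (Ek x))%R.

Definition increasing_on_nonneg (f : \bar R -> \bar R) : Prop :=
  (forall x, 0 <= x -> 0 <= f x) /\
  (forall x y, 0 <= x -> x <= y -> f x <= f y).

End Hypotheses.

(* Main.v *)
(* The false discovery proportion is the sum over the true nulls k of
   1{k rejected} / kstar, where kstar is the number of rejections, and k is
   rejected iff kstar > 0 and alpha e_k >= K / kstar.

   (b) On that event T(alpha e_k) >= K / kstar, so the k-th term is at most
   T(alpha e_k) / K, whose expectation is at most alpha / K.  Raw e-values
   satisfy (b) because T(alpha x) <= alpha x.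

   (a) With B_r = {alpha e_k >= K / r}, the k-th term has expectation
   sum_r (P(kstar <= r, B_r) - P(kstar <= r - 1, B_r)) / r, and the hypothesis
   bounds 1 / r by (alpha / K) / P(B_r).  Since kstar is increasing in the
   e-values and the B_r increase with r, PRDS gives
   P(kstar <= r - 1 | B_r) >= P(kstar <= r - 1 | B_{r-1}), and the sum
   telescopes.  The events B_r are preimages of upsets that need not be closed
   half-lines, so PRDS is first extended to arbitrary upsets by passing to the
   limit; boosting functions are extended to negative arguments by
   x |-> phi (max 0 x), which makes them monotone everywhere. *)
Require Import Defs.
From mathcomp Require Import all_boot all_order all_algebra.
From mathcomp Require Import all_classical all_reals all_analysis.
From mathcomp Require Import measurable_realfun.

Set Implicit Arguments.
Unset Strict Implicit.
Unset Printing Implicit Defensive.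

Import Order.TTheory GRing.Theory Num.Theory.
Import numFieldNormedType.Exports.

Local Open Scope classical_set_scope.
Local Open Scope ring_scope.
Local Open Scope ereal_scope.

(** * The e-BH procedure for fixed e-values *)

(** In a decreasing list the entries that are at least [c] form a prefix, so position [i] lies in it
    iff [i] is below their number. *)
Lemma le_nth_sorted (R : realType) (s : seq (\bar R)) (c : \bar R) (i : nat) :
  sorted (fun x y => y <= x) s -> (i < size s)%N ->
  (c <= nth 0 s i) = (i < count (fun x => (c <= x)%E) s)%N.
Proof.
have tr : transitive (fun x y : \bar R => y <= x).
  by move=> x y z yx xz; exact: le_trans xz yx.
elim: s i => // x s IH i /= xs ilt.
have /allP s_le_x := order_path_min tr xs.
have [cx|xc] /= := boolP (c <= x).
  by case: i ilt => [|i] ilt //=; rewrite IH// (path_sorted xs).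
have ->: count (fun y => c <= y) s = 0%N.
  apply/eqP; rewrite -leqn0 leqNgt -has_count; apply/hasPn => y /s_le_x yx.
  by apply: contra xc => /le_trans; exact.
case: i ilt => [|i] ilt /=; first exact: negbTE.
apply/negbTE; apply: contra xc => /le_trans; apply.
by apply: s_le_x; rewrite mem_nth.
Qed.

Section ebh_combinatorics.
Context {R : realType} {K : nat}.
Implicit Types (e : 'I_K -> \bar R) (alpha : R).

(** Trades order statistics for counts of e-values above a level, whose monotonicity and
    measurability in [e] are visible. *)
Lemma order_stat_ge e (c : \bar R) (i : 'I_K) :
  (c <= order_stat e i) = (i < #|[set j | (c <= e j)%E]%SET|)%N.
Proof.
have tot : total (fun i j : 'I_K => e j <= e i).
  by move=> x y; exact: le_total.
rewrite /order_stat le_nth_sorted; last 2 first.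
- by rewrite sorted_map; exact: sort_sorted.
- by rewrite size_map size_sort size_enum_ord.
rewrite count_map cardsE cardE /enum_mem size_filter.
by rewrite (permP (permEl (perm_sort _ _))) enumT.
Qed.

(** The inequality [K / i.+1 <= alpha * x] solved for [x]: the level that a rejected e-value must
    reach when there are [i.+1] rejections. *)
Definition ebh_cutoff alpha (i : nat) : \bar R := (K%:R / i.+1%:R / alpha)%:E.

Lemma ebh_cutoffE alpha i (x : \bar R) : (0 < alpha)%R ->
  ((K%:R / i.+1%:R)%:E <= alpha%:E * x) = (ebh_cutoff alpha i <= x).
Proof. by move=> a0; rewrite muleC -lee_pdivrMr// -EFinM. Qed.

Lemma ebh_cutoff_le alpha (i j : nat) : (0 < alpha)%R -> (i <= j)%N ->
  ebh_cutoff alpha j <= ebh_cutoff alpha i.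
Proof.
move=> a0 ij; rewrite lee_fin ler_pM2r ?invr_gt0// ler_wpM2l//.
by rewrite lef_pV2 ?posrE ?ltr0n// ler_nat.
Qed.

Lemma kstarE alpha e : (0 < alpha)%R -> kstar alpha e =
  \max_(i < K | (i < #|[set j | (ebh_cutoff alpha i <= e j)%E]%SET|)%N) i.+1.
Proof.
move=> a0; apply: eq_bigl => i.
have K0 : (0 < K%:R :> R)%R by rewrite ltr0n (leq_trans _ (ltn_ord i)).
rewrite lee_pdivlMr// -EFinM -order_stat_ge.
rewrite /ebh_cutoff mulrAC (EFinM (_ / _)) lee_pdivrMr ?ltr0n//.
by rewrite (mulrC K%:R)%R [in RHS]muleC.
Qed.

Lemma kstar_leP alpha e r : (0 < alpha)%R ->
  reflect (forall i : 'I_K,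
      (i < #|[set j | (ebh_cutoff alpha i <= e j)%E]%SET|)%N -> (i < r)%N)
    (kstar alpha e <= r)%N.
Proof. by move=> a0; rewrite kstarE//; exact: bigmax_leqP. Qed.

Lemma kstar_leK alpha e : (0 < alpha)%R -> (kstar alpha e <= K)%N.
Proof. by move=> a0; apply/kstar_leP. Qed.

Lemma le_kstar alpha e e' : (0 < alpha)%R -> (forall k, e k <= e' k) ->
  (kstar alpha e <= kstar alpha e')%N.
Proof.
move=> a0 ee'; apply/kstar_leP => // i ilt.
have /(kstar_leP _ _ a0) := leqnn (kstar alpha e'); apply.
apply: leq_trans ilt _; apply: subset_leq_card; apply/fintype.subsetP => j.
by rewrite !inE => /le_trans; exact.
Qed.

Lemma kstar_witness alpha e : (0 < alpha)%R -> (0 < kstar alpha e)%N ->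
  exists2 i : 'I_K, kstar alpha e = i.+1 &
    (i < #|[set j | (ebh_cutoff alpha i <= e j)%E]%SET|)%N.
Proof.
move=> a0; rewrite kstarE//.
set A := [pred i : 'I_K |
  (i < #|[set j | (ebh_cutoff alpha i <= e j)%E]%SET|)%N].
have [i Ai|A0] := pickP A; last by rewrite big_pred0.
have [|j Aj maxj] := @eq_bigmax_cond _ A (fun i : 'I_K => i.+1).
  by apply/card_gt0P; exists i.
by exists j.
Qed.

Lemma card_ebh alpha e : (0 < alpha)%R -> #|ebh alpha e| = kstar alpha e.
Proof.
move=> a0; rewrite cardsE.
have /card_uniqP -> : uniq (take (kstar alpha e) (ranking e)).
  by rewrite take_uniq// sort_uniq enum_uniq.
by rewrite size_takel// size_sort size_enum_ord kstar_leK.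
Qed.

Lemma mem_ebh alpha e k : (0 < alpha)%R ->
  reflect (exists2 i : 'I_K, kstar alpha e = i.+1 & ebh_cutoff alpha i <= e k)
    (k \in ebh alpha e).
Proof.
move=> a0; have kin : k \in ranking e by rewrite mem_sort mem_enum.
have plt : (index k (ranking e) < K)%N.
  rewrite -[ltnRHS](size_enum_ord K) -(size_sort (fun i j => e j <= e i)).
  by rewrite index_mem.
pose p := Ordinal plt.
have ekE : order_stat e p = e k.
  by rewrite /order_stat (nth_map k) ?index_mem// nth_index.
rewrite inE in_take//; apply: (iffP idP) => [pk|[i ki cek]].
  (* The position [p] of [k] in the ranking is at most [i], and more than [i] values reach cutoff
     [i]; hence so does the value [e k] at position [p]. *)
  have [|i ki ilt] := kstar_witness a0 (e := e); first exact: leq_ltn_trans pk.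
  exists i => //; rewrite -ekE order_stat_ge (leq_ltn_trans _ ilt)//.
  by rewrite -ltnS -ki.
(* If [i < p], then all values up to position [p] reach cutoff [i], hence the lower cutoff [p],
   which forces [kstar] to be at least [p.+1], a contradiction. *)
rewrite ki ltnS leqNgt; apply/negP => ip.
have /(kstar_leP _ _ a0) /(_ p) := leqnn (kstar alpha e).
rewrite ki ltnS -order_stat_ge ekE (le_trans (ebh_cutoff_le a0 (ltnW ip)))//.
by move=> /(_ isT); rewrite leqNgt ip.
Qed.

(* [k rejected] / (number of rejections); the i-th term accounts for exactly
   i.+1 rejections, in which case k is rejected iff e_k reaches the cutoff. *)
Definition ebh_share alpha e (k : 'I_K) : R := (\sum_(i < K)
  ((kstar alpha e == i.+1) && (ebh_cutoff alpha i <= e k)%E)%:R / i.+1%:R)%R.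

Lemma ebh_share_ge0 alpha e k : (0 <= ebh_share alpha e k)%R.
Proof. by apply: sumr_ge0 => i _; rewrite divr_ge0. Qed.

Lemma ebh_share_in alpha e k (i : 'I_K) :
  kstar alpha e = i.+1 -> ebh_cutoff alpha i <= e k ->
  ebh_share alpha e k = i.+1%:R^-1%R.
Proof.
move=> ki cik; rewrite /ebh_share (bigD1 i)//= ki eqxx cik mul1r.
rewrite big1 ?addr0// => j ji.
by rewrite eqSS eq_sym (negbTE (ji : (j : nat) != i)) mul0r.
Qed.

Lemma ebh_share_notin alpha e k : (0 < alpha)%R ->
  k \notin ebh alpha e -> ebh_share alpha e k = 0%R.
Proof.
move=> a0 /(mem_ebh _ _ a0) nk; apply: big1 => i _.
by case: eqP => [ki|_]; case: leP => //= cik; rewrite ?mul0r//;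
  case: nk; exists i.
Qed.

Lemma fdp_ebh alpha e (N : {set 'I_K}) : (0 < alpha)%R ->
  fdp N (ebh alpha e) = (\sum_(k in N) ebh_share alpha e k :> R)%R.
Proof.
move=> a0; rewrite /fdp card_ebh// finset.setIC -sum1_card natr_sum mulr_suml.
rewrite (eq_bigl (fun k => (k \in N) && (k \in ebh alpha e))); last first.
  by move=> k; rewrite inE.
rewrite big_mkcondr/=; apply: eq_bigr => k _.
have [/(mem_ebh _ _ a0)[i ki cik]|nk] := boolP (k \in ebh alpha e).
  by rewrite (ebh_share_in ki cik) ki mul1r.
by rewrite ebh_share_notin.
Qed.

End ebh_combinatorics.
Arguments ebh_cutoff {R} K alpha i.

(** * Upsets and measurability *)

Definition upset (R : realType) (U : set (\bar R)) :=
  forall x y, U x -> x <= y -> U y.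

Section upsets.
Context {R : realType}.
Implicit Types (U V : set (\bar R)).

(** The empty upset falls under the second case: its infimum is [+oo], and nothing lies strictly
    above. *)
Lemma upset_itv U : upset U ->
  U = [set x | ereal_inf U <= x] \/ U = [set x | ereal_inf U < x].
Proof.
move=> upU; have [Uinf|Uinf] := pselect (U (ereal_inf U)); [left|right].
  apply/seteqP; split => [x Ux|x /(upU _ _ Uinf)//].
  by apply: ge_ereal_inf; exists x.
apply/seteqP; split => [x Ux|x /= xU].
  rewrite /= lt_neqAle; apply/andP; split.
    by apply/eqP => infx; apply: Uinf; rewrite infx.
  by apply: ge_ereal_inf; exists x.
by have [y Uy yx] := ereal_inf_lt xU; exact: upU Uy (ltW yx).
Qed.

Lemma upset_measurable U : upset U -> measurable U.
Proof.
move=> /upset_itv[] ->; rewrite -set_itvE; exact: emeasurable_itv.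
Qed.

(** Closed rays generate the Borel sets, and their preimages under a monotone map are upsets. *)
Lemma ereal_nondecreasing_measurable (f : \bar R -> \bar R) :
  {homo f : x y / x <= y} -> measurable_fun [set: \bar R] f.
Proof.
move=> ndf; apply: (measurability _ (ErealGenCInfty.measurableE R)).
move=> _ [_ [r ->] <-]; rewrite setTI; apply: upset_measurable => x y.
by rewrite /= !in_itv/= !andbT => rx /ndf; exact: le_trans.
Qed.

(* For U = {+oo} the thresholds x_n grow to infinity; otherwise they decrease
   to the infimum of U. *)
Lemma upset_approx U : upset U -> U !=set0 -> (forall x, U x -> 0 <= x) ->
  exists2 x : nat -> R, (forall n, (0 <= x n)%R) &
    forall t, 0 <= t -> \forall n \near \oo, ((x n)%:E <= t) = `[< U t >].
Proof.
move=> upU [y Uy] U0.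
have : 0 <= ereal_inf U by apply: le_ereal_inf_tmp => z /U0.
have : ereal_inf U <= y by apply: ge_ereal_inf; exists y.
have := upset_itv upU.
case: (ereal_inf U) => [u| |] // UE uy u0.
- case: UE => UE.
    exists (fun=> u) => [n|t t0]; first by rewrite -lee_fin.
    by near=> n; rewrite UE/= asboolb.
  exists (fun n => u + n.+1%:R^-1)%R => [n|t t0].
    by rewrite addr_ge0.
  rewrite UE/= asboolb; case: t t0 => [t| |] //= _; last first.
    by near=> n; rewrite leey ltry.
  rewrite lte_fin; have [ut|tu] := ltP u t.
    have tu0 : (0 < t - u)%R by rewrite subr_gt0.
    near=> n; rewrite lee_fin -lerBrDl ltW//.
    by near: n; exact: (near_infty_natSinv_lt (PosNum tu0)).
  near=> n; apply/negbTE; rewrite lee_fin -ltNge (le_lt_trans tu)//.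
  by rewrite ltrDl invr_gt0.
- exists (fun n => n%:R)%R => [//|[t| |] // _].
    near=> n; rewrite lee_fin; transitivity false; last first.
      by apply/esym/asboolPn; case: UE => -> /=; rewrite ?leye_eq ?ltNge ?leey.
    by apply/negbTE; rewrite -ltNge; near: n; exact: nbhs_infty_gtr.
  near=> n; rewrite leey; apply/esym/asboolP; exact: upU Uy (leey _).
Unshelve. all: by end_near.
Qed.

End upsets.

(** * Limits of probabilities of events *)

Section limits.
Context d (T : measurableType d) (R : realType) (P : probability T R).

(** Dominated convergence for the indicators, with the constant 1 as dominating function. *)
Lemma probability_cvg (F : nat -> set T) (G : set T) :
  (forall n, measurable (F n)) -> measurable G ->
  (forall w, \forall n \near \oo, F n w <-> G w) ->
  fine (P (F n)) @[n --> \oo] --> fine (P G).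
Proof.
move=> mF mG FG; apply: fine_cvg.
rewrite fineK ?fin_num_measure//.
have E S : measurable S -> P S = \int[P]_w (\1_S w)%:E.
  by move=> mS; rewrite integral_indic// setIT.
rewrite E//; under eq_fun do rewrite E//.
apply: (@dominated_cvg _ _ _ P setT _ _ _ (cst 1)) => //=.
- move=> n; exact/measurable_EFinP/measurable_indic.
- move=> w _; apply: cvg_near_cst; apply: filterS (FG w) => n FnG.
  rewrite !indicE; congr (_%:R%:E).
  by congr nat_of_bool; apply: asbool_equiv_eq.
- exact: finite_measure_integrable_cst.
- by move=> n w _; rewrite lee_fin ger0_norm// indicE; case: (_ \in _).
Qed.
End limits.

(** * Measurability of the number of rejections *)

Section kstar_measurability.
Context d (T : measurableType d) (R : realType) (K : nat).
Variables (alpha : R) (e : 'I_K -> T -> \bar R).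
Hypotheses (a0 : (0 < alpha)%R) (me : forall j, measurable_fun [set: T] (e j)).

Lemma measurable_kstar_le m :
  measurable [set t | (kstar alpha (fun j => e j t) <= m)%N].
Proof.
pose B i j := [set t | ebh_cutoff K alpha i <= e j t].
have mB i j : measurable (B i j).
  by rewrite -[B i j]setTI; exact: emeasurable_fun_c_infty.
(* [C i] is the event that more than [i] e-values reach cutoff [i], split by index sets [S] of
   e-values that do. Then [kstar <= m] means that [C i] fails for every [i >= m]. *)
pose C (i : 'I_K) := \bigcup_(S in [set S : {set 'I_K} | (i < #|S|)%N])
  \bigcap_(j in [set j | j \in S]) B i j.
have mC i : measurable (C i).
  apply: fin_bigcup_measurable => // S _.
  by apply: fin_bigcap_measurable => // j _; exact: mB.
rewrite (_ : [set t | _] = \bigcap_(i in [set i : 'I_K | (m <= i)%N]) ~` C i).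
  by apply: fin_bigcap_measurable => // i _; exact/measurableC/mC.
apply/seteqP; split => t /=.
- move=> /(kstar_leP _ _ a0) tm i /= mi [S /= iS BS].
  suff : (i < m)%N by rewrite ltnNge mi.
  apply: tm; apply: leq_trans iS _; apply: subset_leq_card.
  by apply/fintype.subsetP => j jS; rewrite inE; exact: BS.
- move=> Ct; apply/kstar_leP => // i ilt; rewrite ltnNge; apply/negP => mi.
  apply: (Ct i mi).
  exists [set j | (ebh_cutoff K alpha i <= e j t)%E]%SET => //.
  by move=> j /=; rewrite inE.
Qed.

End kstar_measurability.

(** * PRDS *)

Lemma measurable_tuple_preimage d (T : measurableType d) (R : realType)
    (K : nat) (E : 'I_K -> T -> \bar R) (A : set (K.-tuple (\bar R))) :
  (forall j, measurable_fun [set: T] (E j)) -> measurable A ->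
  measurable [set w | A [tuple E j w | j < K]].
Proof.
move=> mE mA; rewrite -[X in measurable X]setTI.
have mt : measurable_fun [set: T] (fun w => [tuple E j w | j < K]).
  apply/measurable_fun_tnthP => i; apply: eq_measurable_fun (mE i) => w _.
  by rewrite /= tnth_mktuple.
exact: mt.
Qed.

(* Property PRDS for general upsets instead of closed half-lines, with the
   denominators of the conditional probabilities cleared so that null events
   need no special treatment. *)
Lemma PRDS_upset d (T : measurableType d) (R : realType) (K : nat)
    (P : probability T R) (N : {set 'I_K}) (E : 'I_K -> T -> \bar R)
    (A : set (K.-tuple (\bar R))) (k : 'I_K) (U V : set (\bar R)) :
  PRDS P N E -> k \in N ->
  (forall j, measurable_fun [set: T] (E j)) -> (forall j w, 0 <= E j w) ->
  measurable A -> decreasing_set A ->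
  upset U -> upset V -> (forall x, V x -> 0 <= x) -> U `<=` V ->
  let a X := fine (P ([set w | A [tuple E j w | j < K]] `&` E k @^-1` X)) in
  let p X := fine (P (E k @^-1` X)) in
  is_true (a U * p V <= a V * p U)%R.
Proof.
move=> prds kN mE E0 mA dA upU upV V0 UV a p.
have mEA := measurable_tuple_preimage mE mA.
have mpre X : measurable X -> measurable (E k @^-1` X).
  by move=> mX; rewrite -[X in measurable X]setTI; exact: mE.
(* Either [U = V], or some [v] in [V] outside [U] will separate the thresholds that approximate the
   two sets. *)
have [UeqV|/existsNP[v /not_implyP[Vv nUv]]] := pselect (V `<=` U).
  by have -> : U = V by apply/seteqP.
have [->|/set0P U_neq0] := eqVneq U set0.
  by rewrite /a /p preimage_set0 setI0 measure0/= mul0r mulr0.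
have [x x0 xU] := upset_approx upU U_neq0 (fun z Uz => V0 z (UV z Uz)).
have [y y0 yV] := upset_approx upV (ex_intro _ v Vv) V0.
pose ge (r : R) := [set z : \bar R | r%:E <= z].
have mge r : measurable (ge r).
  by apply: upset_measurable => z z' /= rz; exact: le_trans.
have geP X (z : nat -> R) :
  (forall t, 0 <= t -> \forall n \near \oo, ((z n)%:E <= t) = `[< X t >]) ->
  forall w, \forall n \near \oo, (E k @^-1` ge (z n)) w <-> (E k @^-1` X) w.
  move=> zX w; apply: filterS (zX _ (E0 k w)) => n zXn; rewrite /ge /= zXn.
  by split=> [/asboolP|/asboolP].
have p_cvg X (z : nat -> R) : measurable X ->
    (forall t, 0 <= t -> \forall n \near \oo, ((z n)%:E <= t) = `[< X t >]) ->
    p (ge (z n)) @[n --> \oo] --> p X.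
  by move=> mX zX; apply: probability_cvg => [n||]; [exact: mpre..|exact: geP].
have a_cvg X (z : nat -> R) : measurable X ->
    (forall t, 0 <= t -> \forall n \near \oo, ((z n)%:E <= t) = `[< X t >]) ->
    a (ge (z n)) @[n --> \oo] --> a X.
  move=> mX zX; apply: probability_cvg => [n||w].
  - by apply: measurableI => //; exact: mpre.
  - by apply: measurableI => //; exact: mpre.
  - by apply: filterS (geP _ _ zX w) => n zXn; split => -[? /zXn].
have [mU mV] := (upset_measurable upU, upset_measurable upV).
apply: (ler_cvg_to (cvgM (a_cvg _ _ mU xU) (p_cvg _ _ mV yV))
                   (cvgM (a_cvg _ _ mV yV) (p_cvg _ _ mU xU))).
have p_ge0 r : (0 <= p (ge r))%R by exact: fine_ge0.
have ap r : (a (ge r) <= p (ge r))%R.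
  have [mEk mI] := (mpre _ (mge r), measurableI _ _ mEA (mpre _ (mge r))).
  by rewrite fine_le ?fin_num_measure ?le_measure ?inE.
have p_gt0 r : (0 < p (ge r))%R -> 0 < P (E k @^-1` ge r).
  by move=> pr; rewrite -[ltRHS]fineK ?fin_num_measure//; exact: mpre.
(* Evaluated at [v], the approximations give [y n <= v < x n] for large [n]: the order of thresholds
   in which PRDS applies. *)
apply: filterS2 (xU v (V0 v Vv)) (yV v (V0 v Vv)) => n.
rewrite (asboolT Vv) (asboolF nUv) => /negbT; rewrite -ltNge => vx yv.
have yx : (y n <= x n)%R by rewrite -lee_fin (le_trans yv (ltW vx)).
have pxy : (p (ge (x n)) <= p (ge (y n)))%R.
  rewrite fine_le ?fin_num_measure ?le_measure ?inE//; try exact: mpre.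
  by move=> w /=; apply: le_trans; rewrite lee_fin.
change (a (ge (x n)) * p (ge (y n)) <= a (ge (y n)) * p (ge (x n)))%R.
(* If the smaller event is null, both sides vanish; otherwise both conditioning events have positive
   probability. *)
have [px|px] := eqVneq (p (ge (x n))) 0%R.
  have -> : a (ge (x n)) = 0%R.
    by apply/eqP; rewrite eq_le fine_ge0// andbT -px.
  by rewrite px mul0r mulr0.
have px0 : (0 < p (ge (x n)))%R by rewrite lt_neqAle eq_sym px p_ge0.
have py0 := lt_le_trans px0 pxy.
have := prds k kN A mA dA (y n) (x n); rewrite y0 yx => /(_ isT).
move=> /(_ (p_gt0 _ py0) (p_gt0 _ px0)).
by rewrite /cond_prob ler_pdivrMr// mulrAC ler_pdivlMr.
Qed.

(* In the application p i = P(B_i) and a m i = P(kstar <= m, B_i) for the events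
   B_i that the boosted e-value of a fixed true null reaches the i-th cutoff.
   The partial sum up to n is at most c * P(kstar <= n.+1 | B_n). *)
Lemma telescoping_bound (R : realType) (c : R) (p : nat -> R)
    (a : nat -> nat -> R) n :
  (0 <= c)%R ->
  (forall m i, 0 <= a m i <= p i)%R -> (forall m i, a m i <= a m.+1 i)%R ->
  (forall i, p i <= p i.+1)%R ->
  (forall i, (i < n)%N -> p i <= c * i.+1%:R)%R ->
  (forall i, (i.+1 < n)%N -> a i.+1 i * p i.+1 <= a i.+1 i.+1 * p i)%R ->
  (\sum_(i < n) (a i.+1 i - a i i) / i.+1%:R <= c)%R.
Proof.
move=> c0 a_bnd a_mono p_mono p_le cross.
have p_ge0 i : (0 <= p i)%R by have /andP[/le_trans + ap] := a_bnd 0%N i; exact.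
have a0 i m : p i = 0%R -> a m i = 0%R.
  by move=> pi; apply/eqP; have := a_bnd m i; rewrite pi eq_le andbC.
(* The bound on [p i] gives [1 / i.+1 <= c / p i]; if [p i = 0], both numerators vanish. *)
have step i : (p i <= c * i.+1%:R)%R ->
    ((a i.+1 i - a i i) / i.+1%:R <= c * ((a i.+1 i - a i i) / p i))%R.
  move=> pi_le; have [pi0|pi] := eqVneq (p i) 0%R.
    by rewrite !a0// subrr !mul0r mulr0.
  have pgt0 : (0 < p i)%R by rewrite lt_neqAle eq_sym pi p_ge0.
  rewrite mulrCA ler_wpM2l ?subr_ge0// ler_pdivlMr// mulrC.
  by rewrite ler_pdivrMr ?ltr0n.
case: n p_le cross => [|n] p_le cross; first by rewrite big_ord0.
(* The induction keeps the last conditional probability, which is then bounded by 1. *)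
suff : (\sum_(i < n.+1) (a i.+1 i - a i i) / i.+1%:R <= c * (a n.+1 n / p n))%R.
  move=> /le_trans; apply; rewrite -[leRHS]mulr1 ler_wpM2l//.
  have [->|pn] := eqVneq (p n) 0%R; first by rewrite invr0 mulr0.
  rewrite ler_pdivrMr ?mul1r; first by have /andP[] := a_bnd n.+1 n.
  by rewrite lt_neqAle eq_sym pn p_ge0.
elim: n p_le cross => [|n IH] p_le cross.
  rewrite big_ord_recl big_ord0 addr0.
  apply: le_trans (step _ (p_le _ _)) _ => //.
  rewrite ler_wpM2l// ler_wpM2r ?invr_ge0// gerBl.
  by have /andP[] := a_bnd 0%N 0%N.
rewrite big_ord_recr/=.
apply: le_trans (lerD (IH _ _) (step _ (p_le _ _))) _ => //.
- by move=> i /ltnW; exact: p_le.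
- by move=> i /ltnW; exact: cross.
(* After cancelling the new conditional probability, what remains is
   [a n.+1 n / p n <= a n.+1 n.+1 / p n.+1], which is [cross] divided out. *)
rewrite -mulrDr ler_wpM2l// mulrBl addrCA gerDl subr_le0.
have [pn0|pn] := eqVneq (p n) 0%R.
  by rewrite pn0 invr0 mulr0 divr_ge0//; have /andP[] := a_bnd n.+1 n.+1.
have pgt0 : (0 < p n)%R by rewrite lt_neqAle eq_sym pn p_ge0.
by rewrite ler_pdivrMr// mulrAC ler_pdivlMr ?cross// (lt_le_trans pgt0).
Qed.

(** * False discovery rate bounds *)

Section truncation_theory.
Context {R : realType} {K : nat}.
Implicit Types x y : \bar R.

Lemma truncation_le x (c : R) : (0 <= c)%R ->
  (forall i : 'I_K, (K%:R / i.+1%:R)%:E <= x -> (K%:R / i.+1%:R <= c)%R) ->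
  (truncation K x <= c)%R.
Proof. by move=> c0 xc; apply: bigmax_le. Qed.

Lemma le_truncation x (i : 'I_K) :
  (K%:R / i.+1%:R)%:E <= x -> (K%:R / i.+1%:R <= truncation K x)%R.
Proof. by move=> ix; exact: (le_bigmax_cond _ _ ix). Qed.

Lemma truncation_ge0 x : (0 <= truncation K x)%R.
Proof.
rewrite /truncation; elim/big_ind: _ => // y z y0 z0.
by rewrite le_max y0.
Qed.

Lemma truncation_homo : {homo @truncation R K : x y / x <= y >-> (x <= y)%R}.
Proof.
move=> x y xy; apply: truncation_le => [|i ix]; first exact: truncation_ge0.
exact: le_truncation (le_trans ix xy).
Qed.

Lemma truncation_le_id x : 0 <= x -> (truncation K x)%:E <= x.
Proof.
case: x => [x| |] //= x0; last by rewrite leey.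
by rewrite lee_fin; apply: truncation_le.
Qed.

Lemma measurable_truncation d (T : measurableType d) (c : R) (f : T -> \bar R) :
  (0 < c)%R -> measurable_fun [set: T] f ->
  measurable_fun [set: T] (fun w => (truncation K (c%:E * f w))%:E).
Proof.
move=> c0 mf.
apply: (measurableT_comp (f := fun x => (truncation K (c%:E * x))%:E)) => //.
apply: ereal_nondecreasing_measurable => x y xy.
by rewrite lee_fin; apply: truncation_homo; rewrite lee_pmul2l// fin_num.
Qed.

End truncation_theory.

(** * Decomposition of the FDR over the true nulls *)

Section fdr_bounds.
Context d (T : measurableType d) (R : realType) (K : nat).
Variables (P : probability T R) (alpha : R) (e : 'I_K -> T -> \bar R).
Hypotheses (a0 : (0 < alpha)%R) (me : forall j, measurable_fun [set: T] (e j)).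

Let kst w := kstar alpha (fun j => e j w).
Let above k i := [set w | ebh_cutoff K alpha i <= e k w].
Let share k w := ebh_share alpha (fun j => e j w) k.

Let mkst m : measurable [set w | (kst w <= m)%N].
Proof. exact: measurable_kstar_le. Qed.

Let mabove k i : measurable (above k i).
Proof.
by rewrite -[above k i]setTI; exact: emeasurable_fun_c_infty.
Qed.

(** The event that [kstar = i.+1] and [k] is rejected, written as a difference so that its
    probability is a difference of the terms that telescope. *)
Let event k i := [set w | (kst w <= i.+1)%N] `&` above k i `\`
  ([set w | (kst w <= i)%N] `&` above k i).

Let mevent k i : measurable (event k i).
Proof. by apply: measurableD; apply: measurableI. Qed.

Let shareE k w : (share k w)%:E =
  \sum_(i < K) (i.+1%:R^-1)%:E * (\1_(event k i) w)%:E.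
Proof.
rewrite /share /ebh_share -sumEFin; apply: eq_bigr => i _.
rewrite mulrC EFinM; congr (_ * _%:E).
rewrite indicE; congr (nat_of_bool _)%:R; apply/esym.
apply/asbool_equiv_eqP; first exact: andP.
rewrite eqn_leq ltnNge /event /above /=.
split=> [[[kle ab] nle]|[/andP[kle nle] ab]]; split => //.
  by rewrite -!/(kst w) kle /=; apply/negP => kle'; exact: nle.
by case=> kle' _; rewrite -!/(kst w) kle' in nle.
Qed.

Let mshare k : measurable_fun [set: T] (fun w => (share k w)%:E).
Proof.
under eq_fun do rewrite shareE.
apply: emeasurable_sum => i; apply: measurable_funeM.
exact/measurable_EFinP/measurable_indic.
Qed.

Let share_ge0 k w : 0 <= (share k w)%:E.
Proof. by rewrite lee_fin ebh_share_ge0. Qed.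

Lemma fdr_ebhE (N : {set 'I_K}) :
  fdr P N (fun w => ebh alpha (fun j => e j w)) =
  \sum_(k in N) \int[P]_w (share k w)%:E.
Proof.
rewrite /fdr unlock -big_enum -ge0_integral_sum//.
apply: eq_integral => w _; rewrite fdp_ebh// -sumEFin big_enum.
by [].
Qed.

Let int_shareE k : \int[P]_w (share k w)%:E =
  \sum_(i < K) (i.+1%:R^-1)%:E * P (event k i).
Proof.
under eq_integral do rewrite shareE.
have mi i : measurable_fun [set: T] (fun w => (\1_(event k i) w : R)%:E).
  exact/measurable_EFinP/measurable_indic.
rewrite ge0_integral_sum//; last by move=> i; exact: measurable_funeM.
apply: eq_bigr => i _; rewrite ge0_integralZl_EFin//.
by rewrite integral_indic// setIT.
Qed.

Lemma integral_ebh_share k :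
  let a m i := fine (P ([set w | (kstar alpha (fun j => e j w) <= m)%N] `&`
                        [set w | ebh_cutoff K alpha i <= e k w])) in
  \int[P]_w (ebh_share alpha (fun j => e j w) k)%:E =
  (\sum_(i < K) (a i.+1 i - a i i) / i.+1%:R)%:E.
Proof.
move=> a; rewrite int_shareE -sumEFin; apply: eq_bigr => i _.
have mk m : measurable ([set w | (kst w <= m)%N] `&` above k i).
  exact: measurableI.
rewrite mulrC EFinM measureD ?ltey_eq ?fin_num_measure//.
have sub : [set w | (kst w <= i)%N] `&` above k i `<=`
    [set w | (kst w <= i.+1)%N] `&` above k i.
  by apply: setSI => w; exact: leqW.
rewrite (setIidr sub).
by rewrite EFinB /a !fineK ?fin_num_measure//; exact: mk.
Qed.

Lemma fdr_ebh_le (N : {set 'I_K}) :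
  (forall k, k \in N -> \int[P]_w (share k w)%:E <= (alpha / K%:R)%:E) ->
  fdr P N (fun w => ebh alpha (fun j => e j w)) <=
    (#|N|%:R * alpha / K%:R)%:E.
Proof.
move=> share_le; rewrite fdr_ebhE; apply: le_trans (lee_sum _ share_le) _.
by rewrite sumEFin sumr_const -mulrA -(mulr_natl (_ / _)).
Qed.

Lemma fdr_ebh_truncation (N : {set 'I_K}) :
  (forall k, k \in N ->
    'E_P[fun w => truncation K (alpha%:E * e k w)] <= alpha%:E) ->
  fdr P N (fun w => ebh alpha (fun j => e j w)) <=
    (#|N|%:R * alpha / K%:R)%:E.
Proof.
move=> trunc_le; apply: fdr_ebh_le => k kN.
have K0 : (0 < K%:R :> R)%R by rewrite ltr0n (leq_trans _ (ltn_ord k)).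
rewrite EFinM lee_pdivlMr// muleC -ge0_integralZl_EFin//.
apply: le_trans (trunc_le k kN); rewrite unlock; apply: ge0_le_integral => //.
- by move=> w _; rewrite mule_ge0// lee_fin ltW.
- exact: measurable_funeM.
- exact: measurable_truncation.
move=> w _; rewrite -EFinM lee_fin -ler_pdivlMl//.
(* Pointwise, [K] times the share is at most the truncated value: it is [K / i.+1] if [k] is among
   [i.+1] rejections, and 0 if [k] is not rejected. *)
have [/(mem_ebh _ _ a0)[i ki cik]|nk] :=
  boolP (k \in ebh alpha (fun j => e j w)).
  rewrite /share (ebh_share_in ki cik) ler_pdivlMl//.
  by apply: le_truncation; rewrite ebh_cutoffE.
by rewrite /share ebh_share_notin// mulr_ge0 ?invr_ge0 ?truncation_ge0 ?ltW.
Qed.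

End fdr_bounds.

Lemma fdr_ebh_PRDS d (T : measurableType d) (R : realType) (K : nat)
    (P : probability T R) (alpha : R) (N : {set 'I_K})
    (E : 'I_K -> T -> \bar R) (psi : 'I_K -> \bar R -> \bar R) :
  (0 < alpha)%R -> (forall k, {homo psi k : x y / x <= y}) ->
  (forall j, measurable_fun [set: T] (E j)) -> (forall j w, 0 <= E j w) ->
  PRDS P N E ->
  (forall k (i : 'I_K), k \in N ->
    (K%:R / i.+1%:R)%:E *
      P [set w | (K%:R / i.+1%:R)%:E <= alpha%:E * psi k (E k w)]
    <= alpha%:E) ->
  fdr P N (fun w => ebh alpha (fun k => psi k (E k w))) <=
    (#|N|%:R * alpha / K%:R)%:E.
Proof.
move=> a0 psi_homo mE E0 prds tail_le.
pose e j w := psi j (E j w).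
have mpsi k : measurable_fun [set: \bar R] (psi k).
  exact: ereal_nondecreasing_measurable.
have me j : measurable_fun [set: T] (e j).
  exact: measurableT_comp.
apply: (fdr_ebh_le (e := e)) => // k kN; rewrite integral_ebh_share// lee_fin.
have K0 : (0 < K%:R :> R)%R by rewrite ltr0n (leq_trans _ (ltn_ord k)).
pose B i := [set w | ebh_cutoff K alpha i <= e k w].
pose D m := [set w | (kstar alpha (fun j => e j w) <= m)%N].
have mB i : measurable (B i).
  by rewrite -[B i]setTI; exact: emeasurable_fun_c_infty.
have mD m : measurable (D m) by exact: measurable_kstar_le.
have mDB m i : measurable (D m `&` B i) by exact: measurableI.
(* Here the constant [c] is [alpha / K], the bound required for each true null. *)
apply: (@telescoping_bound _ _ (fun i => fine (P (B i)))
  (fun m i => fine (P (D m `&` B i)))).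
- by rewrite divr_ge0 ?ltW.
- move=> m i; rewrite fine_ge0//=.
  by rewrite fine_le ?fin_num_measure ?le_measure ?inE.
- move=> m i; rewrite fine_le ?fin_num_measure ?le_measure ?inE//.
  by apply: setSI => w /=; exact: leqW.
- move=> i; rewrite fine_le ?fin_num_measure ?le_measure ?inE//.
  by move=> w /=; apply: le_trans; exact: ebh_cutoff_le.
- move=> i iK; have := tail_le k (Ordinal iK) kN => /=.
  have -> : [set w | (K%:R / i.+1%:R)%:E <= alpha%:E * psi k (E k w)] = B i.
    by apply/seteqP; split => w /=; rewrite ebh_cutoffE.
  rewrite -[P (B i)]fineK ?fin_num_measure// -EFinM lee_fin.
  rewrite mulrC mulrA ler_pdivrMr ?ltr0n// => h.
  by rewrite mulrAC ler_pdivlMr.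
- move=> i iK.
  (* The vectors of raw e-values with at most [i.+1] rejections form a decreasing set, as [kstar]
     increases with the boosted values; a decreasing set must also lie in the nonnegative
     orthant. *)
  pose A := [set x : K.-tuple (\bar R) | (forall j, 0 <= tnth x j) /\
    (kstar alpha (fun j => psi j (tnth x j)) <= i.+1)%N].
  (* Sets of raw values whose boosted value reaches the cutoff; they grow with [i] because the
     cutoffs decrease. *)
  pose U i := [set x | 0 <= x /\ ebh_cutoff K alpha i <= psi k x].
  have upU j : upset (U j).
    move=> x y [x0 cx] xy; split; first exact: le_trans xy.
    by apply: le_trans cx _; exact: psi_homo.
  have mA : measurable A.
    have m0 : measurable (\bigcap_(j in [set: 'I_K])
        [set x : K.-tuple (\bar R) | 0 <= tnth x j]).
      apply: fin_bigcap_measurable => // j _.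
      rewrite -[X in measurable X]setTI.
      by apply: emeasurable_fun_c_infty => //; exact: measurable_tnth.
    have mk : measurable [set x : K.-tuple (\bar R) |
        (kstar alpha (fun j => psi j (tnth x j)) <= i.+1)%N].
      apply: (measurable_kstar_le (e := fun j x => psi j (tnth x j))) => // j.
      by apply: measurableT_comp => //; exact: measurable_tnth.
    have mI := measurableI _ _ m0 mk; congr measurable: mI.
    apply/seteqP; split => x [x0 xi]; split => // j; first exact: (x0 j).
    by move=> _; exact: x0.
  have dA : decreasing_set A.
    split => [x []//|x y [x0 xi] yx]; split => [j|].
      by have /andP[] := yx j.
    apply: leq_trans xi; apply: le_kstar => // j; apply: psi_homo.
    by have /andP[] := yx j.
  have UV : U i `<=` U i.+1.
    move=> x [x0 cx]; split => //; apply: le_trans cx.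
    exact: ebh_cutoff_le.
  have := PRDS_upset prds kN mE E0 mA dA (upU _) (upU _) _ UV.
  move=> /(_ (fun x => @proj1 _ _)) /=.
  have UB j : E k @^-1` U j = B j.
    by apply/seteqP; split => w /=; [case|split].
  have AD : [set w | A [tuple E j w | j < K]] = D i.+1.
    have tE w : (fun j => psi j (tnth [tuple E j w | j < K] j)) =
        (fun j => e j w) by apply/funext => j; rewrite tnth_mktuple.
    apply/seteqP; split => w; rewrite /A /D /= tE; first by case.
    by split => // j; rewrite tnth_mktuple.
  by rewrite !UB AD.
Qed.

Theorem theorem2 (d : measure_display) (Omega : measurableType d)
    (R : realType) (K : nat) (alpha : R)
    (H : 'I_K -> set (probability Omega R)) (P : probability Omega R)
    (E : 'I_K -> Omega -> \bar R)
    (hK : (1 <= K)%N) (halpha0 : (0 < alpha)%R) (halpha1 : (alpha < 1)%R)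
    (hE : forall k, e_value (H k) (E k)) :
  (forall phi : 'I_K -> \bar R -> \bar R,
     (forall k, increasing_on_nonneg (phi k)) ->
     (PRDS P (true_nulls H P) E /\
      (forall k Q, H k Q ->
         \big[maxe/-oo]_(i < K)
            ((K%:R / i.+1%:R)%:E *
             Q [set w | (K%:R / i.+1%:R)%:E <= alpha%:E * phi k (E k w)])
         <= alpha%:E)
      \/
      (forall k Q, H k Q ->
         'E_Q[fun w => truncation K (alpha%:E * phi k (E k w))]
         <= alpha%:E)) ->
     fdr P (true_nulls H P) (fun w => ebh alpha (fun k => phi k (E k w)))
     <= (#|true_nulls H P|%:R * alpha / K%:R)%:E)
  /\
  fdr P (true_nulls H P) (fun w => ebh alpha (fun k => E k w))
  <= (#|true_nulls H P|%:R * alpha / K%:R)%:E.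
Proof.
have mE k : measurable_fun [set: Omega] (E k) by have [] := hE k.
have E0 k w : 0 <= E k w by have [] := hE k.
have nullP k : k \in true_nulls H P -> H k P by rewrite inE => /asboolP.
split=> [phi phi_incr hyp|]; last first.
  apply: fdr_ebh_truncation => // k /nullP HkP.
  have [_ _ /(_ P HkP) intE] := hE k.
  have a0 : 0 <= alpha%:E by rewrite lee_fin ltW.
  rewrite unlock; apply: (@le_trans _ _ (\int[P]_w (alpha%:E * E k w))).
    apply: ge0_le_integral => //.
    - by move=> w _; rewrite lee_fin truncation_ge0.
    - apply: measurable_truncation => //.
    - exact: measurable_funeM.
    - by move=> w _; apply: truncation_le_id; rewrite mule_ge0.
  rewrite ge0_integralZl_EFin ?(ltW halpha0)//.
  by apply: le_trans (lee_wpmul2l a0 intE) _; rewrite mule1.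
pose psi k x := phi k (maxe 0 x).
have psi_homo k : {homo psi k : x y / x <= y}.
  move=> x y xy; have [_ phi_le] := phi_incr k.
  apply: phi_le; first by rewrite le_max lexx.
  by rewrite ge_max !le_max lexx xy orbT.
have psiE k w : phi k (E k w) = psi k (E k w).
  by rewrite /psi max_r.
(* As [phi k] is monotone only on nonnegative arguments, measurability comes from [psi k], which
   agrees with it on the e-values. *)
have mphi k : measurable_fun [set: Omega] (fun w => phi k (E k w)).
  under eq_fun do rewrite psiE.
  by apply: measurableT_comp => //; exact: ereal_nondecreasing_measurable.
have [[prds tail_le]|trunc_le] := hyp; last first.
  by apply: fdr_ebh_truncation => // k /nullP; exact: trunc_le.
have -> : (fun w => ebh alpha (fun k => phi k (E k w))) =
    (fun w => ebh alpha (fun k => psi k (E k w))).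
  by apply/funext => w; congr ebh; apply/funext => k; exact: psiE.
apply: fdr_ebh_PRDS => // k i /nullP /(tail_le k) tail_k.
apply: le_trans tail_k; under eq_set do rewrite -psiE.
(* Each term is at most the maximum bounded in condition (a). *)
exact: (le_bigmax -oo (fun i : 'I_K => (K%:R / i.+1%:R)%:E *
  P [set w | (K%:R / i.+1%:R)%:E <= alpha%:E * phi k (E k w)])).
Qed.
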